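(* If a category $\mathcal{C}$ is algebraically coherent, then, for each object $X$ of $\mathcal{C}$, the slice category $(\mathcal{C}\downarrow X)$ and the coslice category $(X\downarrow\mathcal{C})$ are also algebraically coherent.
   Context: A cospan $(f\colon X\to Z,\ g\colon Y\to Z)$ in a category with finite limits is jointly strongly epimorphic if every monomorphism into $Z$ through which both $f$ and $g$ factor is an isomorphism. A functor between categories with finite limits is coherent if it preserves finite limits and jointly strongly epimorphic pairs. $\mathsf{Pt}_X(\mathcal{C})$ is the category of points over $X$: objects are triples $(A,\ p\colon A\to X,\ s\colon X\to A)$ with $ps=1_X$, and morphisms are morphisms between the objects $A$ commuting with the $p$'s and the $s$'s. For $f\colon X\to Y$, the change-of-base functor $f^*\colon \mathsf{Pt}_Y(\mathcal{C})\to\mathsf{Pt}_X(\mathcal{C})$ is pulling back along $f$. A category $\mathcal{C}$ with finite limits is algebraically coherent if $f^*$ is coherent for every morphism $f$ of $\mathcal{C}$. Here $(\mathcal{C}\downarrow X)$ is the category of morphisms with codomain $X$, and $(X\downarrow\mathcal{C})$ the category of morphisms with domain $X$. *)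

(* Defs.v *)
From Stdlib Require Import List FinFun ProofIrrelevance ClassicalEpsilon.

Set Implicit Arguments.
Unset Strict Implicit.
Unset Printing Implicit Defensive.

Declare Scope cat_scope.
Delimit Scope cat_scope with cat.
Open Scope cat_scope.

(** Equality of morphisms is Leibniz equality. *)
Record category : Type := Category {
  ob :> Type;
  hom : ob -> ob -> Type;
  idm : forall A : ob, hom A A;
  comp : forall A B D : ob, hom B D -> hom A B -> hom A D;
  comp_id_l : forall (A B : ob) (f : hom A B), comp (idm B) f = f;
  comp_id_r : forall (A B : ob) (f : hom A B), comp f (idm A) = f;
  comp_assoc : forall (A B D E : ob) (h : hom D E) (g : hom B D) (f : hom A B),
    comp h (comp g f) = comp (comp h g) f
}.

Arguments hom {c} A B.
Arguments idm {c} A.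
Arguments comp {c A B D} g f : rename.
Arguments comp_id_l {c A B} f.
Arguments comp_id_r {c A B} f.
Arguments comp_assoc {c A B D E} h g f.

Notation "g ∘ f" := (comp g f) (at level 40, left associativity) : cat_scope.

Record functor (C D : category) : Type := Functor {
  fob :> C -> D;
  fmap : forall A B : C, hom A B -> hom (fob A) (fob B);
  fmap_id : forall A : C, fmap (idm A) = idm (fob A);
  fmap_comp : forall (A B E : C) (g : hom B E) (f : hom A B),
    fmap (g ∘ f) = fmap g ∘ fmap f
}.

Arguments fmap {C D} F {A B} f : rename.
Arguments fmap_id {C D} F A : rename.
Arguments fmap_comp {C D} F {A B E} g f : rename.

Lemma functor_comp_id (C D E : category) (G : functor D E) (F : functor C D)
  (A : C) : fmap G (fmap F (idm A)) = idm (G (F A)).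
Proof. now rewrite !fmap_id. Qed.

Lemma functor_comp_comp (C D E : category) (G : functor D E) (F : functor C D)
  (A B A' : C) (g : hom B A') (f : hom A B) :
  fmap G (fmap F (g ∘ f)) = fmap G (fmap F g) ∘ fmap G (fmap F f).
Proof. now rewrite !fmap_comp. Qed.

Definition functor_comp (C D E : category) (G : functor D E) (F : functor C D) :
  functor C E :=
  @Functor C E (fun A => G (F A)) (fun A B f => fmap G (fmap F f))
    (functor_comp_id G F) (functor_comp_comp G F).

Definition mono (C : category) (A B : C) (m : hom A B) : Prop :=
  forall (W : C) (u v : hom W A), m ∘ u = m ∘ v -> u = v.

Definition is_iso (C : category) (A B : C) (f : hom A B) : Prop :=
  exists g : hom B A, g ∘ f = idm A /\ f ∘ g = idm B.

Definition factors_through (C : category) (A M Z : C) (f : hom A Z) (m : hom M Z) :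
  Prop := exists f' : hom A M, f = m ∘ f'.

Definition jointly_strongly_epic (C : category) (X Y Z : C)
  (f : hom X Z) (g : hom Y Z) : Prop :=
  forall (M : C) (m : hom M Z),
    mono m -> factors_through f m -> factors_through g m -> is_iso m.

(** ** Finite limits *)

Record cone (J C : category) (D : functor J C) : Type := Cone {
  apex : C;
  leg : forall j : J, hom apex (D j);
  leg_comm : forall (i j : J) (a : hom i j), fmap D a ∘ leg i = leg j
}.

Arguments apex {J C D} c : rename.
Arguments leg {J C D} c j : rename.
Arguments leg_comm {J C D} c {i j} a : rename.

Definition is_limit (J C : category) (D : functor J C) (c : cone D) : Prop :=
  forall c' : cone D,
    exists! h : hom (apex c') (apex c), forall j : J, leg c j ∘ h = leg c' j.

Lemma map_cone_comm (J C C' : category) (F : functor C C') (D : functor J C)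
  (c : cone D) (i j : J) (a : hom i j) :
  fmap (functor_comp F D) a ∘ fmap F (leg c i) = fmap F (leg c j).
Proof. simpl. now rewrite <- fmap_comp, leg_comm. Qed.

Definition map_cone (J C C' : category) (F : functor C C') (D : functor J C)
  (c : cone D) : cone (functor_comp F D) :=
  @Cone J C' (functor_comp F D) (F (apex c)) (fun j => fmap F (leg c j))
    (map_cone_comm F c).

Definition finite_category (J : category) : Prop :=
  Finite J /\ forall i j : J, Finite (hom i j).

Definition has_finite_limits (C : category) : Prop :=
  forall J : category, finite_category J ->
  forall D : functor J C, exists c : cone D, is_limit c.

Definition preserves_finite_limits (C C' : category) (F : functor C C') : Prop :=
  forall J : category, finite_category J ->
  forall (D : functor J C) (c : cone D), is_limit c -> is_limit (map_cone F c).

Definition preserves_jointly_strongly_epic (C C' : category) (F : functor C C') :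
  Prop :=
  forall (X Y Z : C) (f : hom X Z) (g : hom Y Z),
    jointly_strongly_epic f g -> jointly_strongly_epic (fmap F f) (fmap F g).

(** Meant for functors between categories with finite limits; [Pt X] has them as
    soon as the base category does. *)
Definition coherent (C C' : category) (F : functor C C') : Prop :=
  preserves_finite_limits F /\ preserves_jointly_strongly_epic F.

(** ** Pullbacks *)

Record pullback (C : category) (A B Z : C) (f : hom A Z) (g : hom B Z) : Type :=
  Pullback {
    pb_ob : C;
    pb_fst : hom pb_ob A;
    pb_snd : hom pb_ob B;
    pb_comm : f ∘ pb_fst = g ∘ pb_snd;
    pb_univ : forall (W : C) (u : hom W A) (v : hom W B), f ∘ u = g ∘ v ->
      exists! h : hom W pb_ob, pb_fst ∘ h = u /\ pb_snd ∘ h = v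
  }.

Arguments pb_ob {C A B Z f g} p : rename.
Arguments pb_fst {C A B Z f g} p : rename.
Arguments pb_snd {C A B Z f g} p : rename.
Arguments pb_comm {C A B Z f g} p : rename.
Arguments pb_univ {C A B Z f g} p {W u v} e : rename.

Definition pb_lift (C : category) (A B Z : C) (f : hom A Z) (g : hom B Z)
  (P : pullback f g) (W : C) (u : hom W A) (v : hom W B) (e : f ∘ u = g ∘ v) :
  hom W (pb_ob P) :=
  proj1_sig (constructive_indefinite_description _ (pb_univ P e)).

Section PullbackLift.
Variables (C : category) (A B Z : C) (f : hom A Z) (g : hom B Z).
Variables (P : pullback f g) (W : C).

Lemma pb_lift_fst (u : hom W A) (v : hom W B) (e : f ∘ u = g ∘ v) :
  pb_fst P ∘ pb_lift P e = u.
Proof.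
unfold pb_lift. destruct constructive_indefinite_description as [h [[H1 H2] Hu]].
exact H1.
Qed.

Lemma pb_lift_snd (u : hom W A) (v : hom W B) (e : f ∘ u = g ∘ v) :
  pb_snd P ∘ pb_lift P e = v.
Proof.
unfold pb_lift. destruct constructive_indefinite_description as [h [[H1 H2] Hu]].
exact H2.
Qed.

Lemma pb_ext (h k : hom W (pb_ob P)) :
  pb_fst P ∘ h = pb_fst P ∘ k -> pb_snd P ∘ h = pb_snd P ∘ k -> h = k.
Proof.
intros H1 H2.
assert (e : f ∘ (pb_fst P ∘ k) = g ∘ (pb_snd P ∘ k)).
{ now rewrite !comp_assoc, pb_comm. }
destruct (pb_univ P e) as [l [_ Hl]].
rewrite <- (Hl h (conj H1 H2)). now apply Hl.
Qed.
End PullbackLift.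

(** The shape [left -> tip <- right]. *)
Inductive cospan_ob : Set := cs_left | cs_right | cs_tip.

Definition cospan_hom (i j : cospan_ob) : Set :=
  match i, j with
  | cs_left, cs_right | cs_right, cs_left
  | cs_tip, cs_left | cs_tip, cs_right => Empty_set
  | _, _ => unit
  end.

Definition cospan_id (i : cospan_ob) : cospan_hom i i :=
  match i with cs_left => tt | cs_right => tt | cs_tip => tt end.

Definition cospan_comp (i j k : cospan_ob) :
  cospan_hom j k -> cospan_hom i j -> cospan_hom i k.
Proof. destruct i, j, k; simpl; tauto. Defined.

Lemma cospan_thin (i j : cospan_ob) (a b : cospan_hom i j) : a = b.
Proof. destruct i, j; destruct a, b; reflexivity. Qed.

Definition cospan : category :=
  @Category cospan_ob cospan_hom cospan_id cospan_comp
    (fun _ _ _ => cospan_thin _ _) (fun _ _ _ => cospan_thin _ _)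
    (fun _ _ _ _ _ _ _ => cospan_thin _ _).

Lemma cospan_finite : finite_category cospan.
Proof.
split.
- exists (cs_left :: cs_right :: cs_tip :: nil). intros []; simpl; tauto.
- intros [] []; simpl;
    first [exists (tt :: nil); intros []; simpl; tauto
          | exists nil; intros []].
Qed.

Section CospanDiagram.
Variables (C : category) (A B Z : C) (f : hom A Z) (g : hom B Z).

Definition cospan_fob (i : cospan) : C :=
  match i with cs_left => A | cs_right => B | cs_tip => Z end.

Definition cospan_fmap (i j : cospan) :
  hom i j -> hom (cospan_fob i) (cospan_fob j) :=
  match i, j return cospan_hom i j -> hom (cospan_fob i) (cospan_fob j) with
  | cs_left, cs_left => fun _ => idm A
  | cs_right, cs_right => fun _ => idm B
  | cs_tip, cs_tip => fun _ => idm Z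
  | cs_left, cs_tip => fun _ => f
  | cs_right, cs_tip => fun _ => g
  | _, _ => fun a => match a with end
  end.

Lemma cospan_fmap_id (i : cospan) : cospan_fmap (idm i) = idm (cospan_fob i).
Proof. destruct i; reflexivity. Qed.

Lemma cospan_fmap_comp (i j k : cospan) (b : hom j k) (a : hom i j) :
  cospan_fmap (b ∘ a) = cospan_fmap b ∘ cospan_fmap a.
Proof.
destruct i, j, k; destruct a, b; simpl;
  rewrite ?comp_id_l, ?comp_id_r; reflexivity.
Qed.

Definition cospan_functor : functor cospan C :=
  @Functor cospan C cospan_fob cospan_fmap cospan_fmap_id cospan_fmap_comp.

Definition cospan_cone (W : C) (u : hom W A) (v : hom W B) (e : f ∘ u = g ∘ v) :
  cone cospan_functor.
Proof.
refine (@Cone cospan C cospan_functor W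
  (fun j => match j return hom W (cospan_fob j) with
            | cs_left => u | cs_right => v | cs_tip => f ∘ u end) _).
intros [] [] []; simpl; rewrite ?comp_id_l; auto.
Defined.

Lemma finite_limits_pullback : has_finite_limits C -> inhabited (pullback f g).
Proof.
intros H. destruct (H cospan cospan_finite cospan_functor) as [c Hc].
pose proof (@leg_comm _ _ _ c cs_left cs_tip tt) as Hl.
pose proof (@leg_comm _ _ _ c cs_right cs_tip tt) as Hr.
simpl in Hl, Hr.
constructor.
apply (@Pullback C A B Z f g (apex c) (leg c cs_left) (leg c cs_right)).
- exact (eq_trans Hl (eq_sym Hr)).
- intros W u v e. destruct (Hc (cospan_cone e)) as [h [Hh Hu]].
  exists h. split.
  + split; [exact (Hh cs_left) | exact (Hh cs_right)].
  + intros k [K1 K2]. apply Hu. intros []; simpl; auto.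
    rewrite <- Hl, <- K1. symmetry. apply comp_assoc.
Qed.
End CospanDiagram.

(** Limits are only assumed to exist, so pullbacks are picked by choice; another
    choice gives a naturally isomorphic change-of-base functor. *)
Definition chosen_pullback (C : category) (H : has_finite_limits C) (A B Z : C)
  (f : hom A Z) (g : hom B Z) : pullback f g :=
  proj1_sig (constructive_indefinite_description (fun _ => True)
    match finite_limits_pullback f g H with
    | inhabits P => ex_intro _ P I
    end).

(** ** Points and change of base *)

Record point (C : category) (X : C) : Type := Point {
  pt_ob : C;
  pt_proj : hom pt_ob X;
  pt_sec : hom X pt_ob;
  pt_split : pt_proj ∘ pt_sec = idm X
}.

Arguments pt_ob {C X} p : rename.
Arguments pt_proj {C X} p : rename.
Arguments pt_sec {C X} p : rename.
Arguments pt_split {C X} p : rename.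

Record point_hom (C : category) (X : C) (P Q : point X) : Type := PointHom {
  pt_map : hom (pt_ob P) (pt_ob Q);
  pt_map_proj : pt_proj Q ∘ pt_map = pt_proj P;
  pt_map_sec : pt_map ∘ pt_sec P = pt_sec Q
}.

Arguments pt_map {C X P Q} h : rename.
Arguments pt_map_proj {C X P Q} h : rename.
Arguments pt_map_sec {C X P Q} h : rename.

Section Points.
Variables (C : category) (X : C).

Lemma point_hom_eq (P Q : point X) (h k : point_hom P Q) :
  pt_map h = pt_map k -> h = k.
Proof.
destruct h as [h h1 h2], k as [k k1 k2]; simpl; intros E; subst k.
f_equal; apply proof_irrelevance.
Qed.

Definition point_id (P : point X) : point_hom P P :=
  PointHom (comp_id_r (pt_proj P)) (comp_id_l (pt_sec P)).

Definition point_comp (P Q R : point X) (k : point_hom Q R) (h : point_hom P Q) :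
  point_hom P R.
Proof.
refine (@PointHom C X P R (pt_map k ∘ pt_map h) _ _).
- now rewrite comp_assoc, !pt_map_proj.
- now rewrite <- comp_assoc, !pt_map_sec.
Defined.

Definition Pt : category.
Proof.
refine (@Category (point X) (@point_hom C X) point_id point_comp _ _ _);
  intros; apply point_hom_eq; simpl.
- apply comp_id_l.
- apply comp_id_r.
- apply comp_assoc.
Defined.
End Points.

Section ChangeOfBase.
Variables (C : category) (H : has_finite_limits C) (X Y : C) (f : hom X Y).

Let pb (P : point Y) : pullback f (pt_proj P) := chosen_pullback H f (pt_proj P).

Lemma base_change_sec_comm (P : point Y) :
  f ∘ idm X = pt_proj P ∘ (pt_sec P ∘ f).
Proof. now rewrite comp_assoc, pt_split, comp_id_l, comp_id_r. Qed.

Definition base_change_ob (P : point Y) : point X :=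
  @Point C X (pb_ob (pb P)) (pb_fst (pb P))
    (pb_lift (pb P) (base_change_sec_comm P))
    (pb_lift_fst (pb P) (base_change_sec_comm P)).

Lemma base_change_map_comm (P Q : point Y) (h : point_hom P Q) :
  f ∘ pb_fst (pb P) = pt_proj Q ∘ (pt_map h ∘ pb_snd (pb P)).
Proof. now rewrite comp_assoc, pt_map_proj, pb_comm. Qed.

Definition base_change_map (P Q : point Y) (h : point_hom P Q) :
  point_hom (base_change_ob P) (base_change_ob Q).
Proof.
refine (@PointHom C X (base_change_ob P) (base_change_ob Q)
          (pb_lift (pb Q) (base_change_map_comm h)) _ _).
- apply pb_lift_fst.
- apply pb_ext; simpl; rewrite comp_assoc.
  + now rewrite !pb_lift_fst.
  + rewrite !pb_lift_snd, <- comp_assoc, pb_lift_snd.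
    now rewrite comp_assoc, pt_map_sec.
Defined.

Definition change_of_base : functor (Pt Y) (Pt X).
Proof.
refine (@Functor (Pt Y) (Pt X) base_change_ob base_change_map _ _);
  intros; apply point_hom_eq; apply pb_ext; simpl.
- now rewrite pb_lift_fst, comp_id_r.
- now rewrite pb_lift_snd, comp_id_l, comp_id_r.
- now rewrite comp_assoc, !pb_lift_fst.
- rewrite comp_assoc, !pb_lift_snd, <- !comp_assoc, pb_lift_snd.
  reflexivity.
Defined.
End ChangeOfBase.

Definition algebraically_coherent (C : category) : Prop :=
  exists H : has_finite_limits C,
    forall (X Y : C) (f : hom X Y), coherent (change_of_base H f).

(** ** Slices and coslices *)

Record slice_ob (C : category) (X : C) : Type := SliceOb {
  sl_dom : C;
  sl_arr : hom sl_dom X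
}.

Record slice_hom (C : category) (X : C) (P Q : slice_ob X) : Type := SliceHom {
  sl_map : hom (sl_dom P) (sl_dom Q);
  sl_comm : sl_arr Q ∘ sl_map = sl_arr P
}.

Record coslice_ob (C : category) (X : C) : Type := CosliceOb {
  cosl_cod : C;
  cosl_arr : hom X cosl_cod
}.

Record coslice_hom (C : category) (X : C) (P Q : coslice_ob X) : Type := CosliceHom {
  cosl_map : hom (cosl_cod P) (cosl_cod Q);
  cosl_comm : cosl_map ∘ cosl_arr P = cosl_arr Q
}.

Section Slices.
Variables (C : category) (X : C).

Lemma slice_hom_eq (P Q : slice_ob X) (h k : slice_hom P Q) :
  sl_map h = sl_map k -> h = k.
Proof.
destruct h as [h h1], k as [k k1]; simpl; intros E; subst k.
f_equal; apply proof_irrelevance.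
Qed.

Definition slice_id (P : slice_ob X) : slice_hom P P :=
  SliceHom (comp_id_r (sl_arr P)).

Definition slice_comp (P Q R : slice_ob X) (k : slice_hom Q R) (h : slice_hom P Q) :
  slice_hom P R.
Proof.
refine (@SliceHom C X P R (sl_map k ∘ sl_map h) _).
now rewrite comp_assoc, !sl_comm.
Defined.

Definition slice : category.
Proof.
refine (@Category (slice_ob X) (@slice_hom C X) slice_id slice_comp _ _ _);
  intros; apply slice_hom_eq; simpl.
- apply comp_id_l.
- apply comp_id_r.
- apply comp_assoc.
Defined.

Lemma coslice_hom_eq (P Q : coslice_ob X) (h k : coslice_hom P Q) :
  cosl_map h = cosl_map k -> h = k.
Proof.
destruct h as [h h1], k as [k k1]; simpl; intros E; subst k.
f_equal; apply proof_irrelevance.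
Qed.

Definition coslice_id (P : coslice_ob X) : coslice_hom P P :=
  CosliceHom (comp_id_l (cosl_arr P)).

Definition coslice_comp (P Q R : coslice_ob X)
  (k : coslice_hom Q R) (h : coslice_hom P Q) : coslice_hom P R.
Proof.
refine (@CosliceHom C X P R (cosl_map k ∘ cosl_map h) _).
now rewrite <- comp_assoc, !cosl_comm.
Defined.

Definition coslice : category.
Proof.
refine (@Category (coslice_ob X) (@coslice_hom C X) coslice_id coslice_comp _ _ _);
  intros; apply coslice_hom_eq; simpl.
- apply comp_id_l.
- apply comp_id_r.
- apply comp_assoc.
Defined.
End Slices.

(* Main.v *)
Require Import Defs.
From Stdlib Require Import List FinFun ClassicalEpsilon.

Set Implicit Arguments.
Unset Strict Implicit.
Unset Printing Implicit Defensive.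

(** A point over an object [Y] of a slice or coslice of [C] is nothing more than a
    point over the underlying object of [C].  In the slice over [X], the structure
    map of a point [A ⇄ Y] must be the composite [A -> Y -> X]; in the coslice
    under [X], its structure map must be the composite [X -> Y -> A].  In either
    case morphisms of points respect these composites automatically.  So the
    forgetful functor [U] to [C] induces equivalences [Pt Y -> Pt (U Y)]
    ([slice_points_equivalence], [coslice_points_equivalence]).

    Moreover [U] preserves pullbacks, so these equivalences commute, up to natural
    isomorphism, with the change-of-base functors along [f] and along [U f].
    Coherence is invariant under equivalence ([coherent_transfer]), hence every
    change of base upstairs inherits it from the change of base in [C]; this is
    [algebraically_coherent_lift], which applies to any functor [U] with the two
    properties above.

    It remains to see that slices and coslices have finite limits.  A limit in the
    slice over [X] is a limit in [C] of the diagram extended by [X] as a new terminal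
    vertex; a limit in the coslice under [X] is a limit in [C] of the underlying
    diagram, the structure maps of the diagram forming a cone with apex [X]. *)

(** * Monomorphisms and isomorphisms *)

Lemma is_iso_mono (C : category) (A B : C) (m : hom A B) : is_iso m -> mono m.
Proof.
intros [n [H _]] W u v E.
now rewrite <- (comp_id_l u), <- (comp_id_l v), <- H, <- !comp_assoc, E.
Qed.

Lemma is_iso_comp (C : category) (A B D : C) (g : hom B D) (f : hom A B) :
  is_iso g -> is_iso f -> is_iso (g ∘ f).
Proof.
intros [g' [G1 G2]] [f' [F1 F2]]. exists (f' ∘ g'). split.
- now rewrite comp_assoc, <- (comp_assoc f'), G1, comp_id_r.
- now rewrite comp_assoc, <- (comp_assoc g), F2, comp_id_r.
Qed.

Lemma mono_comp (C : category) (A B D : C) (g : hom B D) (f : hom A B) :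
  mono g -> mono f -> mono (g ∘ f).
Proof.
intros Hg Hf W u v E. apply Hf, Hg. now rewrite !comp_assoc.
Qed.

Lemma factors_through_iso (C : category) (A B D : C) (f : hom A D)
  (n : hom B D) (B' : C) (e : hom B' B) :
  is_iso e -> factors_through f n -> factors_through f (n ∘ e).
Proof.
intros [e' [_ E]] [h ->]. exists (e' ∘ h).
now rewrite <- comp_assoc, (comp_assoc e), E, comp_id_l.
Qed.

(** A subobject through which the new legs factor also contains the old ones,
    because these, followed by [e], factor through the new legs along [a], [b]. *)
Lemma jointly_strongly_epic_iso (C : category) (X Y Z X' Y' Z' : C)
  (f : hom X Z) (g : hom Y Z) (f' : hom X' Z') (g' : hom Y' Z')
  (a : hom X X') (b : hom Y Y') (e : hom Z Z') :
  is_iso e -> e ∘ f = f' ∘ a -> e ∘ g = g' ∘ b ->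
  jointly_strongly_epic f g -> jointly_strongly_epic f' g'.
Proof.
intros [d [D1 D2]] Ef Eg H M m Hm [u ->] [v ->].
assert (Hd : is_iso d) by (exists e; auto).
assert (I : is_iso (d ∘ m)).
{ apply H.
  - apply mono_comp; [now apply is_iso_mono | exact Hm].
  - exists (u ∘ a).
    now rewrite <- (comp_id_l f), <- D1, <- comp_assoc, Ef, !comp_assoc.
  - exists (v ∘ b).
    now rewrite <- (comp_id_l g), <- D1, <- comp_assoc, Eg, !comp_assoc. }
replace m with (e ∘ (d ∘ m)) by now rewrite comp_assoc, D2, comp_id_l.
apply is_iso_comp; [now exists d | exact I].
Qed.

(** * Coherence is invariant under equivalence *)

Definition faithful (C D : category) (F : functor C D) : Prop :=
  forall (A B : C) (f g : hom A B), fmap F f = fmap F g -> f = g.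

Definition full (C D : category) (F : functor C D) : Prop :=
  forall (A B : C) (h : hom (F A) (F B)), exists f : hom A B, fmap F f = h.

Definition essentially_surjective (C D : category) (F : functor C D) : Prop :=
  forall Y : D, exists (W : C) (e : hom (F W) Y), is_iso e.

Definition equivalence (C D : category) (F : functor C D) : Prop :=
  faithful F /\ full F /\ essentially_surjective F.

Lemma fmap_is_iso (C D : category) (F : functor C D) (A B : C) (f : hom A B) :
  is_iso f -> is_iso (fmap F f).
Proof.
intros [g [H1 H2]]. exists (fmap F g).
now rewrite <- !fmap_comp, H1, H2, !fmap_id.
Qed.

Lemma faithful_mono (C D : category) (F : functor C D) (A B : C) (f : hom A B) :
  faithful F -> mono (fmap F f) -> mono f.
Proof.
intros HF Hm W u v E. apply HF, Hm. now rewrite <- !fmap_comp, E.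
Qed.

Lemma fully_faithful_is_iso (C D : category) (F : functor C D) (A B : C)
  (f : hom A B) :
  faithful F -> full F -> is_iso (fmap F f) -> is_iso f.
Proof.
intros HF HU [g [H1 H2]]. destruct (HU _ _ g) as [k <-].
exists k. split; apply HF; now rewrite fmap_comp, fmap_id.
Qed.

Lemma full_factors_through (C D : category) (F : functor C D) (A M Z : C)
  (f : hom A Z) (m : hom M Z) :
  faithful F -> full F -> factors_through (fmap F f) (fmap F m) ->
  factors_through f m.
Proof.
intros HF HU [h E]. destruct (HU _ _ h) as [k <-].
exists k. apply HF. now rewrite fmap_comp.
Qed.

Lemma fmap_factors_through (C D : category) (F : functor C D) (A M Z : C)
  (f : hom A Z) (m : hom M Z) :
  factors_through f m -> factors_through (fmap F f) (fmap F m).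
Proof. intros [k ->]. exists (fmap F k). apply fmap_comp. Qed.

Section Equivalence.
Variables (C D : category) (F : functor C D).
Hypothesis HF : equivalence F.

Lemma equivalence_mono (A B : C) (f : hom A B) : mono f -> mono (fmap F f).
Proof.
destruct HF as [Ff [Fu Fs]].
intros Hf W u v E. destruct (Fs W) as [W' [e [e' [E1 E2]]]].
destruct (Fu _ _ (u ∘ e)) as [u' Hu], (Fu _ _ (v ∘ e)) as [v' Hv].
assert (u' = v').
{ apply Hf, Ff. now rewrite !fmap_comp, Hu, Hv, !comp_assoc, E. }
subst v'.
now rewrite <- (comp_id_r u), <- (comp_id_r v), <- E2, !comp_assoc, <- Hu, Hv.
Qed.

(** A monomorphism into [F Z] is, up to an isomorphism of its domain, the image
    of a monomorphism into [Z]. *)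
Lemma equivalence_preserves_jointly_strongly_epic :
  preserves_jointly_strongly_epic F.
Proof.
destruct HF as [Ff [Fu Fs]].
intros X Y Z f g H M m Hm Hf Hg.
destruct (Fs M) as [W [e He]].
destruct (Fu _ _ (m ∘ e)) as [n Hn].
assert (I : is_iso (fmap F n)).
{ apply fmap_is_iso, H.
  - apply (faithful_mono Ff). rewrite Hn.
    apply mono_comp; [exact Hm | now apply is_iso_mono].
  - apply (full_factors_through Ff Fu). rewrite Hn. now apply factors_through_iso.
  - apply (full_factors_through Ff Fu). rewrite Hn. now apply factors_through_iso. }
destruct He as [e' [E1 E2]].
replace m with (fmap F n ∘ e')
  by now rewrite Hn, <- comp_assoc, E2, comp_id_r.
apply is_iso_comp; [exact I | now exists e].
Qed.

Lemma equivalence_reflects_jointly_strongly_epic (X Y Z : C)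
  (f : hom X Z) (g : hom Y Z) :
  jointly_strongly_epic (fmap F f) (fmap F g) -> jointly_strongly_epic f g.
Proof.
destruct HF as [Ff [Fu _]].
intros H M m Hm Hf Hg. apply (fully_faithful_is_iso Ff Fu), H.
- now apply equivalence_mono.
- now apply fmap_factors_through.
- now apply fmap_factors_through.
Qed.

(** A cone over [F ∘ D] has, up to isomorphism, an apex of the form [F W]; by
    fullness and faithfulness it then comes from a cone over [D] with apex [W]. *)
Lemma equivalence_preserves_limit (J : category) (D' : functor J C)
  (c : cone D') : is_limit c -> is_limit (map_cone F c).
Proof.
destruct HF as [Ff [Fu Fs]].
intros Hc c'.
destruct (Fs (apex c')) as [W [e [e' [E1 E2]]]].
set (pick := fun j => constructive_indefinite_description _
  (Fu W (D' j) (leg c' j ∘ e))).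
assert (Hp : forall j, fmap F (proj1_sig (pick j)) = leg c' j ∘ e)
  by (intros j; exact (proj2_sig (pick j))).
assert (K : forall (i j : J) (a : hom i j),
  fmap D' a ∘ proj1_sig (pick i) = proj1_sig (pick j)).
{ intros i j a. apply Ff. rewrite fmap_comp, !Hp, comp_assoc.
  exact (f_equal (fun z => z ∘ e) (leg_comm c' a)). }
destruct (Hc (Cone K)) as [h [Hh Hu]]. simpl in h, Hh, Hu.
exists (fmap F h ∘ e'). split.
- intros j. simpl.
  now rewrite comp_assoc, <- fmap_comp, Hh, Hp, <- comp_assoc, E2, comp_id_r.
- intros k Hk. simpl in k, Hk.
  destruct (Fu _ _ (k ∘ e)) as [l Hl].
  assert (h = l).
  { apply Hu. intros j. apply Ff. now rewrite fmap_comp, Hl, Hp, comp_assoc, Hk. }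
  subst l. now rewrite Hl, <- comp_assoc, E2, comp_id_r.
Qed.

(** A mediating map between the images is the image of a mediating map, by
    fullness; faithfulness makes it commute with the legs and be unique. *)
Lemma equivalence_reflects_limit (J : category) (D' : functor J C)
  (c : cone D') : is_limit (map_cone F c) -> is_limit c.
Proof.
destruct HF as [Ff [Fu _]].
intros Hc c'. destruct (Hc (map_cone F c')) as [h [Hh Hu]]. simpl in h, Hh, Hu.
destruct (Fu _ _ h) as [k <-]. exists k. split.
- intros j. apply Ff. now rewrite fmap_comp.
- intros l Hl. apply Ff, Hu. intros j. now rewrite <- fmap_comp, Hl.
Qed.
End Equivalence.

(** Composing with [a] turns cones over [D1] into cones over [D2]; a factorization
    through [c2] then gives one through [c1], its equations being tested after the
    monomorphisms [a j]. *)
Lemma is_limit_iso (J C : category) (D1 D2 : functor J C)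
  (a : forall j, hom (D1 j) (D2 j)) (c1 : cone D1) (c2 : cone D2)
  (e : hom (apex c1) (apex c2)) :
  (forall j, mono (a j)) ->
  (forall (i j : J) (x : hom i j), a j ∘ fmap D1 x = fmap D2 x ∘ a i) ->
  is_iso e -> (forall j, leg c2 j ∘ e = a j ∘ leg c1 j) ->
  is_limit c2 -> is_limit c1.
Proof.
intros Ha Hn [e' [E1 E2]] He Hc c.
assert (K : forall (i j : J) (x : hom i j),
  fmap D2 x ∘ (a i ∘ leg c i) = a j ∘ leg c j).
{ intros i j x. now rewrite comp_assoc, <- Hn, <- comp_assoc, leg_comm. }
destruct (Hc (Cone K)) as [h [Hh Hu]]. simpl in h, Hh, Hu.
exists (e' ∘ h). split.
- intros j. apply Ha.
  now rewrite !comp_assoc, <- He, <- (comp_assoc (leg c2 j)), E2, comp_id_r, Hh.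
- intros k Hk. rewrite (Hu (e ∘ k)).
  + now rewrite comp_assoc, E1, comp_id_l.
  + intros j. now rewrite comp_assoc, He, <- comp_assoc, Hk.
Qed.

(** In a square commuting up to isomorphism, [E] carries limits and jointly strongly
    epic pairs to the domain of [F'], which preserves them, and [G] reflects the
    result back to the codomain of [F]. *)
Lemma coherent_transfer (A B A' B' : category) (E : functor A A')
  (G : functor B B') (F : functor A B) (F' : functor A' B')
  (b : forall P : A, hom (G (F P)) (F' (E P))) :
  (forall P, is_iso (b P)) ->
  (forall (P Q : A) (h : hom P Q),
     b Q ∘ fmap G (fmap F h) = fmap F' (fmap E h) ∘ b P) ->
  equivalence E -> equivalence G -> coherent F' -> coherent F.
Proof.
intros Hb Hn HE HG [HL HS]. split.
- intros J HJ D c Hc. apply (equivalence_reflects_limit HG).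
  apply (@is_limit_iso J B' (functor_comp G (functor_comp F D))
    (functor_comp F' (functor_comp E D)) (fun j => b (D j))
    (map_cone G (map_cone F c))
    (map_cone F' (map_cone E c)) (b (apex c))).
  + intros j. apply is_iso_mono, Hb.
  + intros i j x. apply Hn.
  + apply Hb.
  + intros j. symmetry. apply Hn.
  + apply (HL J HJ), (equivalence_preserves_limit HE), Hc.
- intros X Y Z f g H. apply (equivalence_reflects_jointly_strongly_epic HG).
  destruct (Hb Z) as [d [D1 D2]].
  destruct (Hb X) as [x [X1 X2]], (Hb Y) as [y [Y1 Y2]].
  (* The comparison isomorphisms go from [G ∘ F] to [F' ∘ E], so the inverses
     carry the known pair to the wanted one. *)
  apply (@jointly_strongly_epic_iso B' _ _ _ _ _ _
    (fmap F' (fmap E f)) (fmap F' (fmap E g)) _ _ x y d).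
  + now exists (b Z).
  + rewrite <- (comp_id_r (fmap F' (fmap E f))), <- X2, (comp_assoc _ (b X)), <- Hn.
    now rewrite !comp_assoc, D1, comp_id_l.
  + rewrite <- (comp_id_r (fmap F' (fmap E g))), <- Y2, (comp_assoc _ (b Y)), <- Hn.
    now rewrite !comp_assoc, D1, comp_id_l.
  + apply HS, (equivalence_preserves_jointly_strongly_epic HE), H.
Qed.

(** * Lifting algebraic coherence along a functor *)

(** Stated on the pullback record rather than on cospan-shaped limit cones, since
    the chosen pullbacks behind the change of base come in this form. *)
Definition preserves_pullbacks (D C : category) (U : functor D C) : Prop :=
  forall (A B Z : D) (f : hom A Z) (g : hom B Z) (P : pullback f g)
    (W : C) (u : hom W (U A)) (v : hom W (U B)), fmap U f ∘ u = fmap U g ∘ v ->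
  exists! h : hom W (U (pb_ob P)),
    fmap U (pb_fst P) ∘ h = u /\ fmap U (pb_snd P) ∘ h = v.

Lemma pullback_image_comm (D C : category) (U : functor D C)
  (A B Z : D) (f : hom A Z) (g : hom B Z) (P : pullback f g) :
  fmap U f ∘ fmap U (pb_fst P) = fmap U g ∘ fmap U (pb_snd P).
Proof. now rewrite <- !fmap_comp, pb_comm. Qed.

Definition pullback_image (D C : category) (U : functor D C)
  (HU : preserves_pullbacks U) (A B Z : D) (f : hom A Z) (g : hom B Z)
  (P : pullback f g) : pullback (fmap U f) (fmap U g) :=
  Pullback (pullback_image_comm U P) (HU _ _ _ _ _ P).

Lemma pullback_comparison_is_iso (C : category) (A B Z : C) (f : hom A Z)
  (g : hom B Z) (P Q : pullback f g) : is_iso (pb_lift Q (pb_comm P)).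
Proof.
exists (pb_lift P (pb_comm Q)).
split; apply pb_ext; rewrite comp_assoc, comp_id_r.
- now rewrite !pb_lift_fst.
- now rewrite !pb_lift_snd.
- now rewrite !pb_lift_fst.
- now rewrite !pb_lift_snd.
Qed.

Lemma point_hom_is_iso (C : category) (X : C) (P Q : Pt X) (h : hom P Q) :
  is_iso (pt_map h) -> is_iso h.
Proof.
intros [k [K1 K2]].
assert (E1 : pt_proj P ∘ k = pt_proj Q).
{ now rewrite <- (pt_map_proj h), <- comp_assoc, K2, comp_id_r. }
assert (E2 : k ∘ pt_sec Q = pt_sec P).
{ now rewrite <- (pt_map_sec h), comp_assoc, K1, comp_id_l. }
exists (PointHom E1 E2). split; now apply point_hom_eq.
Qed.

Section PointsFunctor.
Variables (D C : category) (U : functor D C) (Y : D).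

Lemma points_functor_split (P : point Y) :
  fmap U (pt_proj P) ∘ fmap U (pt_sec P) = idm (U Y).
Proof. now rewrite <- fmap_comp, pt_split, fmap_id. Qed.

Definition points_functor_ob (P : point Y) : point (U Y) :=
  Point (points_functor_split P).

Definition points_functor_map (P Q : point Y) (h : point_hom P Q) :
  point_hom (points_functor_ob P) (points_functor_ob Q).
Proof.
refine (@PointHom C _ (points_functor_ob P) (points_functor_ob Q)
  (fmap U (pt_map h)) _ _); simpl; rewrite <- fmap_comp.
- now rewrite pt_map_proj.
- now rewrite pt_map_sec.
Defined.

Definition points_functor : functor (Pt Y) (Pt (U Y)).
Proof.
refine (@Functor (Pt Y) (Pt (U Y)) points_functor_ob points_functor_map _ _);
  intros; apply point_hom_eq; simpl.
- apply fmap_id.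
- apply fmap_comp.
Defined.
End PointsFunctor.

Section Comparison.
Variables (D C : category) (U : functor D C) (HU : preserves_pullbacks U).
Variables (HD : has_finite_limits D) (HC : has_finite_limits C).
Variables (X Y : D) (f : hom X Y).

Let pbD (P : point Y) := chosen_pullback HD f (pt_proj P).
Let pbC (P : point Y) := chosen_pullback HC (fmap U f) (fmap U (pt_proj P)).

Definition change_of_base_comparison (P : Pt Y) :
  hom (points_functor U X (change_of_base HD f P))
      (change_of_base HC (fmap U f) (points_functor U Y P)).
Proof.
refine (@PointHom C (U X) (points_functor U X (change_of_base HD f P))
  (change_of_base HC (fmap U f) (points_functor U Y P))
  (pb_lift (pbC P) (pullback_image_comm U (pbD P))) _ _).
- apply pb_lift_fst.
- apply (@pb_ext _ _ _ _ _ _ (pbC P)); rewrite comp_assoc; simpl.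
  + unfold pbC. now rewrite !pb_lift_fst, <- fmap_comp, pb_lift_fst, fmap_id.
  + unfold pbC. now rewrite !pb_lift_snd, <- !fmap_comp, pb_lift_snd.
Defined.

Lemma change_of_base_comparison_is_iso (P : Pt Y) :
  is_iso (change_of_base_comparison P).
Proof.
apply point_hom_is_iso.
exact (pullback_comparison_is_iso (pullback_image HU (pbD P)) (pbC P)).
Qed.

Lemma change_of_base_comparison_natural (P Q : Pt Y) (h : hom P Q) :
  change_of_base_comparison Q
    ∘ fmap (points_functor U X) (fmap (change_of_base HD f) h)
  = fmap (change_of_base HC (fmap U f)) (fmap (points_functor U Y) h)
    ∘ change_of_base_comparison P.
Proof.
apply point_hom_eq. apply (@pb_ext _ _ _ _ _ _ (pbC Q)); simpl;
  unfold pbC, pbD; rewrite !comp_assoc.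
- now rewrite !pb_lift_fst, <- fmap_comp, pb_lift_fst.
- rewrite !pb_lift_snd, <- comp_assoc, pb_lift_snd.
  now rewrite <- !fmap_comp, pb_lift_snd.
Qed.
End Comparison.

(** A pullback is determined up to a unique isomorphism, so [U] carries the change
    of base along [f] to the one along [U f] whichever pullbacks are chosen. *)
Theorem algebraically_coherent_lift (D C : category) (U : functor D C) :
  has_finite_limits D -> preserves_pullbacks U ->
  (forall Y : D, equivalence (points_functor U Y)) ->
  algebraically_coherent C -> algebraically_coherent D.
Proof.
intros HD HU HE [HC H]. exists HD. intros X Y f.
apply (coherent_transfer
  (change_of_base_comparison_is_iso HU HD HC f)
  (change_of_base_comparison_natural U HD HC f)); auto.
Qed.

(** * Slices *)

(** A diagram of this shape sending the new terminal object [None] to [X] is the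
    same as a diagram of shape [J] in the slice over [X]; the extra vertex keeps
    the limit correct when [J] is empty or disconnected. *)
Section AddTerminal.
Variable J : category.

Definition add_terminal_hom (i j : option J) : Type :=
  match i, j with
  | Some i, Some j => hom i j
  | _, None => unit
  | None, Some _ => Empty_set
  end.

Definition add_terminal_id (i : option J) : add_terminal_hom i i :=
  match i with Some i => idm i | None => tt end.

Definition add_terminal_comp (i j k : option J) :
  add_terminal_hom j k -> add_terminal_hom i j -> add_terminal_hom i k.
Proof.
destruct i as [i|], j as [j|], k as [k|]; simpl;
  try (intros; exact tt); try (intros [] || intros ? []).
exact (fun b a => b ∘ a).
Defined.

Definition add_terminal : category.
Proof.
refine (@Category (option J) add_terminal_hom add_terminal_id
  add_terminal_comp _ _ _).
- intros [i|] [j|] f; simpl in *; try destruct f; try reflexivity.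
  apply comp_id_l.
- intros [i|] [j|] f; simpl in *; try destruct f; try reflexivity.
  apply comp_id_r.
- intros [i|] [j|] [k|] [l|] h g f; simpl in *;
    try destruct f; try destruct g; try destruct h; try reflexivity.
  apply comp_assoc.
Defined.

Lemma add_terminal_finite : finite_category J -> finite_category add_terminal.
Proof.
intros [[l Hl] H]. split.
- exists (None :: map Some l). intros [j|]; simpl; auto.
  right. apply in_map, Hl.
- intros [i|] [j|]; simpl.
  + apply H.
  + exists (tt :: nil). intros []; simpl; auto.
  + exists nil. intros [].
  + exists (tt :: nil). intros []; simpl; auto.
Qed.
End AddTerminal.

Section Slice.
Variables (C : category) (X : C).

Definition slice_forget : functor (slice X) C :=
  @Functor (slice X) C (@sl_dom C X) (@sl_map C X)
    (fun _ => eq_refl) (fun _ _ _ _ _ => eq_refl).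

Section ExtendedDiagram.
Variables (J : category) (D : functor J (slice X)).

Definition extended_fob (i : add_terminal J) : C :=
  match i with Some j => sl_dom (D j) | None => X end.

Definition extended_fmap (i j : add_terminal J) :
  hom i j -> hom (extended_fob i) (extended_fob j) :=
  match i, j return
    add_terminal_hom i j -> hom (extended_fob i) (extended_fob j) with
  | Some i, Some j => fun a => sl_map (fmap D a)
  | Some i, None => fun _ => sl_arr (D i)
  | None, None => fun _ => idm X
  | None, Some _ => fun a => match a with end
  end.

Definition extended_functor : functor (add_terminal J) C.
Proof.
refine (@Functor (add_terminal J) C extended_fob extended_fmap _ _).
- intros [i|]; simpl; [now rewrite fmap_id | reflexivity].
- intros [i|] [j|] [k|] g f; simpl in *;
    try destruct f; try destruct g; simpl;
    rewrite ?comp_id_l; try reflexivity.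
  + now rewrite fmap_comp.
  + symmetry. exact (sl_comm (fmap D f)).
Defined.

Definition extended_cone (c : cone D) : cone extended_functor.
Proof.
refine (@Cone _ _ extended_functor (sl_dom (apex c))
  (fun i => match i return hom _ (extended_fob i) with
            | Some j => sl_map (leg c j) | None => sl_arr (apex c) end) _).
intros [i|] [j|] a; simpl in *; try destruct a; rewrite ?comp_id_l;
  try reflexivity.
- now rewrite <- (leg_comm c a).
- apply sl_comm.
Defined.
End ExtendedDiagram.

Lemma slice_has_finite_limits : has_finite_limits C -> has_finite_limits (slice X).
Proof.
intros H J HJ D.
destruct (H _ (add_terminal_finite HJ) (extended_functor D)) as [c Hc].
pose (A := SliceOb (leg c None)).
pose (l := fun j => @SliceHom C X A (D j) (leg c (Some j))
  (@leg_comm _ _ _ c (Some j) None tt)).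
assert (K : forall (i j : J) (a : hom i j), fmap D a ∘ l i = l j).
{ intros i j a. apply slice_hom_eq. simpl.
  exact (@leg_comm _ _ _ c (Some i) (Some j) a). }
exists (@Cone _ _ D (A : slice X) l K).
intros c'. destruct (Hc (extended_cone c')) as [h [Hh Hu]]. simpl in h, Hh, Hu.
exists (@SliceHom C X (apex c') A h (Hh None)). split.
- intros j. apply slice_hom_eq. exact (Hh (Some j)).
- intros k Hk. apply slice_hom_eq. simpl. apply Hu. intros [j|].
  + exact (f_equal (@sl_map _ _ _ _) (Hk j)).
  + exact (sl_comm k).
Qed.

(** A cone in [C] over a cospan of the slice has exactly one structure map to [X]
    making it a cone in the slice. *)
Lemma slice_forget_preserves_pullbacks : preserves_pullbacks slice_forget.
Proof.
intros A B Z f g P W u v E. simpl in *.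
pose (W' := SliceOb (sl_arr A ∘ u)).
assert (Ev : sl_arr B ∘ v = sl_arr A ∘ u).
{ now rewrite <- (sl_comm f), <- (sl_comm g), <- !comp_assoc, E. }
pose (u' := @SliceHom C X W' A u eq_refl).
pose (v' := @SliceHom C X W' B v Ev).
assert (E' : @comp (slice X) _ _ _ f u' = @comp (slice X) _ _ _ g v')
  by (now apply slice_hom_eq).
destruct (pb_univ P E') as [h [[H1 H2] Hu]].
exists (sl_map h). split.
- split.
  + exact (f_equal (@sl_map _ _ _ _) H1).
  + exact (f_equal (@sl_map _ _ _ _) H2).
- intros k [K1 K2].
  assert (Ek : sl_arr (pb_ob P) ∘ k = sl_arr A ∘ u).
  { now rewrite <- (sl_comm (pb_fst P)), <- comp_assoc, K1. }
  pose (k' := @SliceHom C X W' (pb_ob P) k Ek).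
  apply (f_equal (@sl_map _ _ _ _) (x := h) (y := k')), Hu.
  split; now apply slice_hom_eq.
Qed.

Lemma slice_points_equivalence (Y : slice X) :
  equivalence (points_functor slice_forget Y).
Proof.
split; [|split].
- intros P Q f g E. apply point_hom_eq, slice_hom_eq.
  exact (f_equal (@pt_map _ _ _ _) E).
- intros P Q h.
  assert (E : sl_arr (pt_ob Q) ∘ pt_map h = sl_arr (pt_ob P)).
  { rewrite <- (sl_comm (pt_proj Q)), <- (sl_comm (pt_proj P)), <- comp_assoc.
    f_equal. exact (pt_map_proj h). }
  unshelve eexists (@PointHom (slice X) Y P Q (SliceHom E) _ _).
  + apply slice_hom_eq. exact (pt_map_proj h).
  + apply slice_hom_eq. exact (pt_map_sec h).
  + now apply point_hom_eq.
- intros P. simpl in P.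
  pose (A := @SliceOb C X (pt_ob P) (sl_arr Y ∘ pt_proj P)).
  assert (Es : sl_arr A ∘ pt_sec P = sl_arr Y).
  { simpl. now rewrite <- comp_assoc, pt_split, comp_id_r. }
  pose (p := @SliceHom C X A Y (pt_proj P) eq_refl).
  pose (s := @SliceHom C X Y A (pt_sec P) Es).
  assert (Ep : @comp (slice X) _ _ _ p s = @idm (slice X) Y).
  { apply slice_hom_eq. exact (pt_split P). }
  exists (@Point (slice X) Y A p s Ep).
  unshelve eexists (@PointHom C _ (points_functor_ob slice_forget
    (@Point (slice X) Y A p s Ep)) P (idm _) _ _); simpl.
  + apply comp_id_r.
  + apply comp_id_l.
  + apply point_hom_is_iso. simpl. exists (idm _). now rewrite comp_id_l.
Qed.
End Slice.

(** * Coslices *)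

Section Coslice.
Variables (C : category) (X : C).

Definition coslice_forget : functor (coslice X) C :=
  @Functor (coslice X) C (@cosl_cod C X) (@cosl_map C X)
    (fun _ => eq_refl) (fun _ _ _ _ _ => eq_refl).

(** The apex of the limit in [C] receives its structure map as the factorization
    of the cone with apex [X]; a mediating map respects structure maps because
    such factorizations are unique. *)
Lemma coslice_has_finite_limits :
  has_finite_limits C -> has_finite_limits (coslice X).
Proof.
intros H J HJ D.
destruct (H _ HJ (functor_comp coslice_forget D)) as [c Hc].
pose (cX := @Cone J C (functor_comp coslice_forget D) X
  (fun j => cosl_arr (D j)) (fun i j a => cosl_comm (fmap D a))).
destruct (Hc cX) as [x [Hx Ux]]. simpl in x, Hx, Ux.
pose (A := CosliceOb x).
pose (l := fun j => @CosliceHom C X A (D j) (leg c j) (Hx j)).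
assert (K : forall (i j : J) (a : hom i j), fmap D a ∘ l i = l j).
{ intros i j a. apply coslice_hom_eq. exact (leg_comm c a). }
exists (@Cone _ _ D (A : coslice X) l K).
intros c'. destruct (Hc (map_cone coslice_forget c')) as [h [Hh Hu]].
simpl in h, Hh, Hu.
assert (Eh : h ∘ cosl_arr (apex c') = x).
{ symmetry. apply Ux. intros j. rewrite comp_assoc, Hh. apply cosl_comm. }
exists (@CosliceHom C X (apex c') A h Eh). split.
- intros j. apply coslice_hom_eq. exact (Hh j).
- intros k Hk. apply coslice_hom_eq. simpl. apply Hu. intros j.
  exact (f_equal (@cosl_map _ _ _ _) (Hk j)).
Qed.

(** An arbitrary object of [C] does not lift to the coslice, so the universal
    property of a pullback [P] in the coslice cannot be tested in [C] directly.
    Instead the pullback [Q] in [C] lifts to the coslice, and [P] and [Q] are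
    isomorphic over the cospan. *)
Lemma coslice_forget_preserves_pullbacks :
  has_finite_limits C -> preserves_pullbacks coslice_forget.
Proof.
intros H A B Z f g P W u v E. simpl in *.
destruct (finite_limits_pullback (cosl_map f) (cosl_map g) H) as [Q].
assert (EX : cosl_map f ∘ cosl_arr A = cosl_map g ∘ cosl_arr B)
  by now rewrite !cosl_comm.
pose (Q' := CosliceOb (pb_lift Q EX)).
pose (q1 := @CosliceHom C X Q' A (pb_fst Q) (pb_lift_fst Q EX)).
pose (q2 := @CosliceHom C X Q' B (pb_snd Q) (pb_lift_snd Q EX)).
assert (EQ : @comp (coslice X) _ _ _ f q1 = @comp (coslice X) _ _ _ g q2).
{ apply coslice_hom_eq. exact (pb_comm Q). }
pose (i := pb_lift P EQ).
pose (m := cosl_map i : hom (pb_ob Q) (cosl_cod (pb_ob P))).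
assert (I1 : cosl_map (pb_fst P) ∘ m = pb_fst Q)
  by exact (f_equal (@cosl_map _ _ _ _) (pb_lift_fst P EQ)).
assert (I2 : cosl_map (pb_snd P) ∘ m = pb_snd Q)
  by exact (f_equal (@cosl_map _ _ _ _) (pb_lift_snd P EQ)).
assert (EP : cosl_map f ∘ cosl_map (pb_fst P) = cosl_map g ∘ cosl_map (pb_snd P))
  by exact (f_equal (@cosl_map _ _ _ _) (pb_comm P)).
assert (Ej : pb_lift Q EP ∘ cosl_arr (pb_ob P) = cosl_arr Q').
{ apply pb_ext; simpl; rewrite comp_assoc.
  - now rewrite !pb_lift_fst, cosl_comm.
  - now rewrite !pb_lift_snd, cosl_comm. }
pose (j := @CosliceHom C X (pb_ob P) Q' (pb_lift Q EP) Ej).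
assert (IJ : m ∘ pb_lift Q EP = idm _).
{ apply (f_equal (@cosl_map _ _ _ _)
    (x := @comp (coslice X) _ _ _ i j) (y := @idm (coslice X) _)).
  apply (@pb_ext (coslice X) _ _ _ _ _ P); apply coslice_hom_eq.
  - change (cosl_map (pb_fst P) ∘ (m ∘ pb_lift Q EP)
      = cosl_map (pb_fst P) ∘ idm _).
    now rewrite comp_assoc, I1, pb_lift_fst, comp_id_r.
  - change (cosl_map (pb_snd P) ∘ (m ∘ pb_lift Q EP)
      = cosl_map (pb_snd P) ∘ idm _).
    now rewrite comp_assoc, I2, pb_lift_snd, comp_id_r. }
exists (m ∘ pb_lift Q E). split.
- split; rewrite comp_assoc.
  + now rewrite I1, pb_lift_fst.
  + now rewrite I2, pb_lift_snd.
- intros k [K1 K2].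
  rewrite <- (comp_id_l k), <- IJ, <- comp_assoc. f_equal.
  apply pb_ext; rewrite comp_assoc.
  + now rewrite !pb_lift_fst.
  + now rewrite !pb_lift_snd.
Qed.

(** Fullness uses the section of a point, where the slice uses its projection. *)
Lemma coslice_points_equivalence (Y : coslice X) :
  equivalence (points_functor coslice_forget Y).
Proof.
split; [|split].
- intros P Q f g E. apply point_hom_eq, coslice_hom_eq.
  exact (f_equal (@pt_map _ _ _ _) E).
- intros P Q h.
  assert (E : pt_map h ∘ cosl_arr (pt_ob P) = cosl_arr (pt_ob Q)).
  { rewrite <- (cosl_comm (pt_sec Q)), <- (cosl_comm (pt_sec P)), comp_assoc.
    f_equal. exact (pt_map_sec h). }
  unshelve eexists (@PointHom (coslice X) Y P Q (CosliceHom E) _ _).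
  + apply coslice_hom_eq. exact (pt_map_proj h).
  + apply coslice_hom_eq. exact (pt_map_sec h).
  + now apply point_hom_eq.
- intros P. simpl in P.
  pose (A := @CosliceOb C X (pt_ob P) (pt_sec P ∘ cosl_arr Y)).
  assert (Ep : pt_proj P ∘ cosl_arr A = cosl_arr Y).
  { simpl. now rewrite comp_assoc, pt_split, comp_id_l. }
  pose (p := @CosliceHom C X A Y (pt_proj P) Ep).
  pose (s := @CosliceHom C X Y A (pt_sec P) eq_refl).
  assert (Es : @comp (coslice X) _ _ _ p s = @idm (coslice X) Y).
  { apply coslice_hom_eq. exact (pt_split P). }
  exists (@Point (coslice X) Y A p s Es).
  unshelve eexists (@PointHom C _ (points_functor_ob coslice_forget
    (@Point (coslice X) Y A p s Es)) P (idm _) _ _); simpl.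
  + apply comp_id_r.
  + apply comp_id_l.
  + apply point_hom_is_iso. simpl. exists (idm _). now rewrite comp_id_l.
Qed.
End Coslice.

Theorem proposition3p4 (C : category) (hC : algebraically_coherent C) (X : C) :
  algebraically_coherent (slice X) /\ algebraically_coherent (coslice X).
Proof.
destruct hC as [HC H]. split.
- apply (algebraically_coherent_lift (slice_has_finite_limits HC)
    (@slice_forget_preserves_pullbacks C X) (@slice_points_equivalence C X)).
  now exists HC.
- apply (algebraically_coherent_lift (coslice_has_finite_limits HC)
    (coslice_forget_preserves_pullbacks (X := X) HC)
    (@coslice_points_equivalence C X)).
  now exists HC.
Qed.
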